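(* Let $a,c$ be nonzero complex numbers and let $\ell,m,n$ be nonnegative integers with $m\le n$. Then $$ {}_4\phi_3\left[\begin{matrix}a,\,c,\,q^{-n},\,-q^{1-\ell-m+n}a/c\\ q^{1-\ell}a/c,\,q^{1-m+n}a,\,-q^{-n}c\end{matrix};q,q\right] =\frac{(a,\,c;q)_\ell}{(q^{\ell-1}c^2,\,q^{1-\ell}a/c;q)_\ell}\, \frac{(q^{1-m+n},\,-qa/c;q)_n}{(q^{1-m+n}a,\,-q/c;q)_n}\sum_{i=0}^{\ell}\sum_{j=0}^{m}T_{i,j}, $$ where $$ T_{i,j}=q^{\ell i+(m-n)j+\binom{j+1}{2}}\Big(\frac{c}{a}\Big)^i\,\frac{1-q^{1-2\ell+2i}/c^2}{1-q^{1-2\ell}/c^2}\, \frac{(q^{-\ell},\,q^{1-\ell}a/c^2,\,q^{1-2\ell}/c^2;q)_i}{(q,\,q^{1-\ell}/a,\,q^{2-\ell}/c^2;q)_i} $$ $$ \times\frac{(q^{-m},\,q^{-n},\,-q^{-n},\,q^{\ell-i}a,\,q^{1-\ell+i}a/c^2;q)_j}{(q,\,qa/c,\,-qa/c,\,q^{m-2n},\,q^{j-2n-1};q)_j}\, \frac{(q^{1+\ell-i+j}a,\,q^{2-\ell+i+j}a/c^2;q^2)_{n-j}}{(q,\,q^{2+2j}a^2/c^2;q^2)_{n-j}}. $$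
   Context: $q$ is a nonzero complex number. For complex $x$ and an integer $n\ge 0$, the $q$-shifted factorial is $(x;q)_0=1$, $(x;q)_n=\prod_{k=0}^{n-1}(1-xq^k)$, and $(x_1,\dots,x_r;q)_n=\prod_{s=1}^r (x_s;q)_n$ (likewise with base $q^2$ in place of $q$). The basic hypergeometric series is ${}_4\phi_3\left[\begin{matrix}a_0,a_1,a_2,a_3\\ b_1,b_2,b_3\end{matrix};q,z\right]=\sum_{k\ge0}\frac{(a_0,a_1,a_2,a_3;q)_k}{(q,b_1,b_2,b_3;q)_k}z^k$. Here one upper parameter is $q^{-n}$, so the series terminates and means the sum over $0\le k\le n$. Parameters are assumed to be such that no zero factor appears in a denominator of the displayed expressions. *)

(* Defs.v *)
From mathcomp Require Import all_boot all_order all_algebra.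
From mathcomp Require Import reals complex.

Set Implicit Arguments.
Unset Strict Implicit.
Unset Printing Implicit Defensive.

Import GRing.Theory.
Local Open Scope ring_scope.

(* (x; q)_n *)
Definition qpoch (F : fieldType) (q x : F) (n : nat) : F :=
  \prod_(k < n) (1 - x * q ^+ k).

(* (x_1, ..., x_r; q)_n *)
Definition qpochs (F : fieldType) (q : F) (xs : seq F) (n : nat) : F :=
  \prod_(x <- xs) qpoch q x n.

(* The partial sum 0 <= k <= N of the series 4phi3.  When one of the upper
   parameters is q ^ (- N) this is the terminating series itself; the
   truncation is explicit because the lower factorials may vanish for k > N. *)
Definition phi43 (F : fieldType) (N : nat)
    (a0 a1 a2 a3 b1 b2 b3 q z : F) : F :=
  \sum_(k < N.+1)
    qpochs q [:: a0; a1; a2; a3] k / qpochs q [:: q; b1; b2; b3] k * z ^+ k.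

(* Powers of q with an exponent in int are integer powers (exprz).  The natural
   subtraction n - j is exact for j <= m <= n. *)
Definition Tterm (F : fieldType) (q a c : F) (l m n i j : nat) : F :=
  q ^ (l%:Z * i%:Z + (m%:Z - n%:Z) * j%:Z + 'C(j.+1, 2)%:Z) * (c / a) ^+ i
  * ((1 - q ^ (1 - 2 * l%:Z + 2 * i%:Z) / c ^+ 2)
     / (1 - q ^ (1 - 2 * l%:Z) / c ^+ 2))
  * (qpochs q [:: q ^ (- l%:Z);
                  q ^ (1 - l%:Z) * a / c ^+ 2;
                  q ^ (1 - 2 * l%:Z) / c ^+ 2] i
     / qpochs q [:: q; q ^ (1 - l%:Z) / a; q ^ (2 - l%:Z) / c ^+ 2] i)
  * (qpochs q [:: q ^ (- m%:Z);
                  q ^ (- n%:Z);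
                  - q ^ (- n%:Z);
                  q ^ (l%:Z - i%:Z) * a;
                  q ^ (1 - l%:Z + i%:Z) * a / c ^+ 2] j
     / qpochs q [:: q;
                    q * a / c;
                    - q * a / c;
                    q ^ (m%:Z - 2 * n%:Z);
                    q ^ (j%:Z - 2 * n%:Z - 1)] j)
  * (qpochs (q ^+ 2) [:: q ^ (1 + l%:Z - i%:Z + j%:Z) * a;
                         q ^ (2 - l%:Z + i%:Z + j%:Z) * a / c ^+ 2] (n - j)
     / qpochs (q ^+ 2) [:: q; q ^+ (2 + 2 * j) * a ^+ 2 / c ^+ 2] (n - j)).

(* Main.v *)
Require Import Defs.
From mathcomp Require Import all_boot all_order all_algebra.
From mathcomp Require Import reals complex.
From mathcomp Require Import ring.

(** Write the left-hand side as Phi(l, m, n; a, c).  Three relations between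
    balanced terminating 4phi3 series suffice, each obtained by telescoping:
    - Phi(l+1; a, c) is a combination of Phi(l; qa, qc) and Phi(l; a, c), which
      after l steps expands it over the Phi(0; q^(l-i) a, q^(l-i) c);
    - for l = 0, Phi(m+1, n; a) is a combination of Phi(m, n; a) and
      Phi(m, n-1; qa), which after m steps expands it over the closed forms of
      the Phi(0, 0, n-j; q^j a, c);
    - for l = m = 0 the series is well-poised and satisfies a first-order
      recurrence in n.
    The coefficients of the two expansions solve the same recurrences as the
    factors of T_{i,j}.

    These recurrences divide by factors such as 1 - q^(2n) a, which the
    hypotheses allow to vanish.  So the identity is proved over F(t) at the
    generic point of the line joining (q, a, c), at t = 0, to (2, 3, 5), at
    t = 1; both sides are regular at t = 0, where they take the desired values. *)

Import Order.TTheory GRing.Theory Num.Theory.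
Local Open Scope ring_scope.

(** * Contiguous relations *)

Ltac nonzero := repeat (apply/andP; split); rewrite ?oner_eq0 ?opprK //.

Section QPochhammer.
Variables (F : fieldType) (q : F).

Lemma qpoch0 x : qpoch q x 0 = 1.
Proof. by rewrite /qpoch big_ord0. Qed.

Lemma qpochS x n : qpoch q x n.+1 = qpoch q x n * (1 - x * q ^+ n).
Proof. by rewrite /qpoch big_ord_recr. Qed.

Lemma qpochSl x n : qpoch q x n.+1 = (1 - x) * qpoch q (q * x) n.
Proof.
rewrite /qpoch big_ord_recl expr0 mulr1; congr (_ * _).
by apply: eq_bigr => k _; rewrite /= exprS mulrCA mulrA.
Qed.

Lemma qpochs_nil n : qpochs q [::] n = 1.
Proof. by rewrite /qpochs big_nil. Qed.

Lemma qpochs_cons x s n : qpochs q (x :: s) n = qpoch q x n * qpochs q s n.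
Proof. by rewrite /qpochs big_cons. Qed.

Lemma qpoch_shift x n :
  qpoch q (q * x) n * (1 - x) = qpoch q x n * (1 - x * q ^+ n).
Proof. by rewrite -qpochS qpochSl mulrC. Qed.

Lemma qpoch_shiftE x n : 1 - x != 0 ->
  qpoch q (q * x) n = qpoch q x n * (1 - x * q ^+ n) / (1 - x).
Proof. by move=> x1; rewrite -qpoch_shift mulfK. Qed.

(** Supplies the side conditions that [field] meets in a telescoping step. *)
Lemma qpoch_neq0S x n : (forall k, qpoch q x k != 0) ->
  [/\ qpoch q x n != 0, 1 - x * (q * q ^+ n) != 0 & 1 - x * q ^+ n != 0].
Proof.
move=> hx; have := hx n.+2; rewrite !qpochS !mulf_eq0 !negb_or exprS.
by case/andP=> /andP[].
Qed.

Lemma sub_div_neq0 (u v x : F) : v != 0 -> 1 - u / v * x != 0 -> v - u * x != 0.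
Proof.
move=> v0; rewrite (_ : 1 - _ = (v - u * x) / v); last by field.
by rewrite mulf_eq0 negb_or => /andP[].
Qed.

End QPochhammer.

Arguments qpoch0 {F q}.
Arguments qpochS {F q}.
Arguments qpochSl {F q}.
Arguments qpoch_shift {F q}.
Arguments qpoch_shiftE {F q}.
Arguments qpoch_neq0S {F q}.
Arguments sub_div_neq0 {F}.

Section QSeries.
Variables (F : fieldType) (q : F).
Hypotheses (q0 : q != 0) (q_nonroot : forall k, q ^+ k.+1 != 1).

Let expq_neq0 k : q ^+ k != 0. Proof. exact: expf_neq0. Qed.

Lemma qpochq_neq0 k : qpoch q q k != 0.
Proof. by apply/prodf_neq0 => i _; rewrite subr_eq0 eq_sym -exprS. Qed.

Definition phi43_term a0 a1 a2 a3 b1 b2 b3 k : F :=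
  qpoch q a0 k * qpoch q a1 k * qpoch q a2 k * qpoch q a3 k
  / (qpoch q q k * qpoch q b1 k * qpoch q b2 k * qpoch q b3 k) * q ^+ k.

Lemma phi43E n a0 a1 a2 a3 b1 b2 b3 :
  phi43 n a0 a1 a2 a3 b1 b2 b3 q q
  = \sum_(k < n.+1) phi43_term a0 a1 a2 a3 b1 b2 b3 k.
Proof.
by apply: eq_bigr => k _; rewrite !qpochs_cons !qpochs_nil !mulr1 /phi43_term !mulrA.
Qed.

(* The right-hand side is G(K+1), where G(k+1) - G(k) is the combination of
   the k-th terms.  The linear factor of G in q^k is found by comparing both
   sides at q^k = 1/f and q^k = 1/g; balancing then cancels the top degree. *)
Lemma contiguous_telescope (a c N d e f g : F) K :
  a != 0 -> c != 0 -> N != 0 ->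
  e * f * g = q * a * c * N * d ->
  (forall k, qpoch q e k != 0) ->
  (forall k, qpoch q f k != 0) -> (forall k, qpoch q g k != 0) ->
  1 - a != 0 -> 1 - c != 0 ->
  let alpha := (e - a * c) * (1 - e) in
  let gamma := - (q * a * c * d - e * (f + g - N)) * (1 - a) * (1 - c)
               / ((1 - f) * (1 - g)) in
  let beta := (e - a * c * d * q) * (1 - a) * (1 - c) * (1 - N)
              / ((1 - f) * (1 - g)) - alpha - gamma in
  alpha * \sum_(k < K.+1) phi43_term a c N d e f g k
  + beta * \sum_(k < K.+1) phi43_term a c N (q * d) (q * e) f g k
  + gamma * \sum_(k < K.+1) phi43_term (q * a) (q * c) N (q * d) (q * e) (q * f)
    (q * g) k
  = (e - a * c * d * q ^+ K.+1)
    * (qpoch q a K.+1 * qpoch q c K.+1 * qpoch q N K.+1 * qpoch q (q * d) K)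
    / (qpoch q q K * qpoch q (q * e) K * qpoch q f K.+1 * qpoch q g K.+1).
Proof.
move=> a0 c0 N0 bal he hf hg ha hc alpha gamma beta.
have f1 : 1 - f != 0 by have := hf 1; rewrite qpochS qpoch0 mul1r mulr1.
have g1 : 1 - g != 0 by have := hg 1; rewrite qpochS qpoch0 mul1r mulr1.
have e1 : 1 - e != 0 by have := he 1; rewrite qpochS qpoch0 mul1r mulr1.
elim: K => [|K IH].
  (* At K = 0 the three sums are 1, and the claim is the defining equation of [beta]. *)
  rewrite !big_ord_recl !big_ord0 /phi43_term !qpochS !qpoch0 expr0 expr1 /beta
    /gamma /alpha.
  by field; nonzero.
have split3 (x y z s1 s2 s3 : F) : alpha * (s1 + x) + beta * (s2 + y)
    + gamma * (s3 + z) = (alpha * s1 + beta * s2 + gamma * s3)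
                         + (alpha * x + beta * y + gamma * z).
  by ring.
have recr (h : nat -> F) : \sum_(k < K.+2) h k = \sum_(k < K.+1) h k + h K.+1.
  by rewrite big_ord_recr.
rewrite !recr split3 IH /phi43_term /= {IH split3 recr}.
(* The balancing condition is solved for d, so that the remaining variables are independent and
   [field] can decide the step. *)
have ed : d = e * f * g / (q * a * c * N) by rewrite bal; field; rewrite q0 a0 c0 N0.
rewrite (qpoch_shiftE _ _ ha) (qpoch_shiftE _ _ hc) (qpoch_shiftE _ _ f1)
  (qpoch_shiftE _ _ g1).
have [q2 _ q3] := qpoch_neq0S _ K qpochq_neq0.
have [f2 f3 f4] := qpoch_neq0S _ K hf.
have [g2 g3 g4] := qpoch_neq0S _ K hg.
have := he K.+2; rewrite qpochSl qpochS mulf_eq0 negb_or => /andP[_].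
rewrite mulf_eq0 negb_or => /andP[e2 e3].
rewrite (qpochSl d) (qpochSl e) ![qpoch q _ K.+2]qpochS ![qpoch q _ K.+1]qpochS.
rewrite /beta /gamma /alpha {beta gamma alpha he hf hg}.
move: e1 f1 g1 ha hc e2 e3 q2 q3 g2 g3 g4 f2 f3 f4; rewrite !exprS {bal}ed {d}.
(* With q^K and the shifted factorials replaced by variables, a rational identity is left. *)
set x := q ^+ K.
set qd := qpoch _ (q * (_ / _)) K.
move: qd (qpoch q (q * e) K) (qpoch q q K) (qpoch q f K) (qpoch q g K)
  (qpoch q a K) (qpoch q c K) (qpoch q N K) => qd E Q f' g' a' c' N' *.
by field; nonzero.
Qed.

(* Q stands for q^n; the two series are the well-poised ones for n and n - 1. *)
Lemma wellpoised_telescope (a c Q : F) K :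
  a != 0 -> c != 0 -> Q != 0 ->
  (forall k, qpoch q (q * a / c) k != 0) ->
  (forall k, qpoch q (Q * a) k != 0) -> (forall k, qpoch q (- c / Q) k != 0) ->
  1 - Q != 0 -> c - Q * a != 0 -> 1 - Q ^+ 2 * a != 0 -> c + Q * a != 0 ->
  let lambda := (1 - Q * a) * (Q + 1) * (c ^+ 2 - Q ^+ 2 * a)
                / ((c - Q * a) * (1 - Q ^+ 2 * a) * (Q + c)) in
  \sum_(k < K.+1) phi43_term a c Q^-1 (q * (- Q * a / c)) (q * a / c) (q * (Q * a))
    (- c / Q) k
  - lambda * \sum_(k < K.+1) phi43_term a c (q * Q^-1) (- Q * a / c) (q * a / c)
    (Q * a) (q * (- c / Q)) k
  = - Q * (c + Q ^+ 2 * a) / ((1 - Q) * (c - Q * a) * (1 - Q ^+ 2 * a))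
    * (qpoch q a K.+1 * qpoch q c K.+1 * qpoch q Q^-1 K.+1 * qpoch q
      (q * (- Q * a / c)) K)
    / (qpoch q q K * qpoch q (q * a / c) K * qpoch q (q * (Q * a)) K * qpoch q
      (- c / Q) K.+1).
Proof.
move=> a0 c0 Q0 he hf hg Q1 cQa Q2a cQa' lambda.
have f1 : 1 - Q * a != 0 by have := hf 1; rewrite qpochS qpoch0 mul1r mulr1.
have g1 : 1 - (- c / Q) != 0 by have := hg 1; rewrite qpochS qpoch0 mul1r mulr1.
have g2 : Q + c != 0.
  have := g1; rewrite (_ : _ - _ = (Q + c) / Q); last by field; nonzero.
  by rewrite mulf_eq0 negb_or => /andP[].
have d1 : 1 - (- Q * a / c) != 0.
  by rewrite (_ : _ - _ = (c + Q * a) / c) ?mulf_neq0 ?invr_eq0 //; field; nonzero.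
have N1 : 1 - Q^-1 != 0.
  by rewrite (_ : _ - _ = - (1 - Q) / Q) ?mulf_neq0 ?oppr_eq0 ?invr_eq0 //; field;
    nonzero.
elim: K => [|K IH].
  rewrite !big_ord_recl !big_ord0 /phi43_term !qpochS !qpoch0 expr0 /lambda.
  by field; nonzero.
have split2 (x y s1 s2 : F) : s1 + x - lambda * (s2 + y)
    = (s1 - lambda * s2) + (x - lambda * y) by ring.
have recr (h : nat -> F) : \sum_(k < K.+2) h k = \sum_(k < K.+1) h k + h K.+1.
  by rewrite big_ord_recr.
rewrite !recr split2 IH /phi43_term /= {IH split2 recr}.
rewrite (qpoch_shiftE _ _ g1) (qpoch_shiftE _ _ N1).
have [q2 _ q3] := qpoch_neq0S _ K qpochq_neq0.
have [e2 _ e3] := qpoch_neq0S _ K he; have e4 := sub_div_neq0 _ _ _ c0 e3.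
have := hf K.+2; rewrite qpochSl qpochS mulf_eq0 negb_or => /andP[_].
rewrite mulf_eq0 negb_or => /andP[f2 f3].
have [g3 g4 g5] := qpoch_neq0S _ K hg.
have [g6 g7] := (sub_div_neq0 _ _ _ Q0 g4, sub_div_neq0 _ _ _ Q0 g5).
have Q1' : Q - 1 != 0 by rewrite -opprB oppr_eq0.
rewrite (qpochSl (Q * a)) (qpochSl (- Q * a / c)) ![qpoch q _ K.+2]qpochS
  ![qpoch q _ K.+1]qpochS.
rewrite /lambda {lambda he hf hg}.
move: q2 q3 e2 e3 f2 f3 g3 g4 g5 d1 N1 g1 f1 e4 g6 g7; rewrite ?(exprS q).
set x := q ^+ K.
move: (qpoch q q K) (qpoch q a K) (qpoch q c K) (qpoch q Q^-1 K) (qpoch q (q * a / c) K)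
  (qpoch q (- c / Q) K) (qpoch q (q * (Q * a)) K) (qpoch q (q * (- Q * a / c)) K) => 
  q' a' c' N' e' g' f' d' *.
by field; nonzero.
Qed.

(** * Generic parameters *)

(* For q != 0: u is not an integer power of q. *)
Definition nonres (u : F) := forall i j, u * q ^+ i != q ^+ j.

(** The pair (i, j) encodes the integer exponent j - i between u and v; cross-multiplying moves it
    into the exponents of [nonres]. *)
Lemma nonres_eq u v i j : nonres u -> v * q ^+ i = u * q ^+ j -> nonres v.
Proof.
move=> hu uv k l; apply: contraNneq (hu (j + k)%N (l + i)%N) => h.
by rewrite exprD mulrA -uv mulrAC h -exprD.
Qed.

Lemma nonres_shift u k : nonres u -> nonres (q ^+ k * u).
Proof. by move=> hu; apply: (nonres_eq _ _ 0 k hu); rewrite mulr1 mulrC. Qed.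

Lemma nonres_mulq u : nonres u -> nonres (q * u).
Proof. exact: (nonres_shift u 1). Qed.

Lemma nonres_div u k : nonres u -> nonres (u / q ^+ k).
Proof. by move=> hu; apply: (nonres_eq _ _ k 0 hu); rewrite mulr1 divfK. Qed.

Lemma nonres_inv u : u != 0 -> nonres u -> nonres u^-1.
Proof.
move=> u0 hu i j; apply: contraNneq (hu j i) => h.
by rewrite -h mulVKf.
Qed.

Lemma nonres_sub u : nonres u -> 1 - u != 0.
Proof. by move=> hu; rewrite subr_eq0 eq_sym; have := hu 0 0; rewrite !mulr1. Qed.

Lemma nonres_neq0 u k : nonres u -> 1 - u * q ^+ k != 0.
Proof. by move=> hu; rewrite subr_eq0 eq_sym; exact: (hu k 0%N). Qed.

Lemma nonres_qpoch u k : nonres u -> qpoch q u k != 0.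
Proof. by move=> hu; apply/prodf_neq0 => i _; exact: nonres_neq0. Qed.

(** The factor of index n is 1 - q^{-n} q^n. This ends the series and removes the boundary terms of
    the telescoping sums. *)
Lemma qpoch_vanish n k : (n < k)%N -> qpoch q (q ^+ n)^-1 k = 0.
Proof.
move=> nk; apply/eqP/prodf_eq0; exists (Ordinal nk) => //=.
by rewrite mulVf ?subrr.
Qed.

Lemma phi43_term_vanish n k a0 a1 a3 b1 b2 b3 : (n < k)%N ->
  phi43_term a0 a1 (q ^+ n)^-1 a3 b1 b2 b3 k = 0.
Proof. by move=> nk; rewrite /phi43_term qpoch_vanish // !(mulr0, mul0r). Qed.

(** Together with q not being a root of unity, this keeps nonzero the denominators met below, which
    are built from differences of powers of q and from 1 - u q^i with i an integer and u one of a,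
    -c, c^2, a/c, -a/c. The conditions are stable under multiplying a and c by powers of q, as the
    expansions require. *)
Record generic (a c : F) : Prop := Generic {
  generic_a : a != 0;
  generic_c : c != 0;
  nonres_a : nonres a;
  nonres_Nc : nonres (- c);
  nonres_cc : nonres (c ^+ 2);
  nonres_ac : nonres (a / c);
  nonres_Nac : nonres (- (a / c)) }.

Lemma generic_shift a c i j : generic a c -> generic (q ^+ i * a) (q ^+ j * c).
Proof.
case=> a0 c0 ha hc hcc hac hnac.
have E : q ^+ i * a / (q ^+ j * c) = q ^+ i * (a / c) / q ^+ j.
  by field; nonzero.
split; rewrite ?mulf_neq0 // ?E.
- exact: nonres_shift.
- by rewrite -mulrN; exact: nonres_shift.
- by rewrite exprMn -exprM; exact: nonres_shift.
- by apply: nonres_div; exact: nonres_shift.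
- by rewrite -mulNr -mulrN; apply: nonres_div; exact: nonres_shift.
Qed.

Lemma generic_sub_ac a c i : generic a c -> c - q ^+ i * a != 0.
Proof.
case=> a0 c0 _ _ _ hac _; rewrite (_ : _ - _ = c * (1 - q ^+ i * (a / c))); last
  by field.
by rewrite mulf_neq0 ?nonres_sub //; exact: nonres_shift.
Qed.

Lemma generic_add_ac a c i : generic a c -> c + q ^+ i * a != 0.
Proof.
case=> a0 c0 _ _ _ _ hac; rewrite (_ : _ + _ = c * (1 - q ^+ i * - (a / c))); last
  by field.
by rewrite mulf_neq0 ?nonres_sub //; exact: nonres_shift.
Qed.

Lemma generic_add_c a c i : generic a c -> q ^+ i + c != 0.
Proof.
case=> _ _ _ hc _ _ _; rewrite (_ : _ + _ = q ^+ i * (1 - - c / q ^+ i)); last by field.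
by rewrite mulf_neq0 ?nonres_sub //; exact: nonres_div.
Qed.

Lemma qpoch2q_neq0 k : qpoch (q ^+ 2) q k != 0.
Proof.
by apply/prodf_neq0 => i _; rewrite subr_eq0 eq_sym -exprM -exprS.
Qed.

(** Each factor is a difference of squares and splits into a factor for a/c and one for -a/c. *)
Lemma generic_qpoch2 a c i k : generic a c ->
  qpoch (q ^+ 2) ((q ^+ i * a / c) ^+ 2) k != 0.
Proof.
case=> a0 c0 _ _ _ hac hnac; apply/prodf_neq0 => j _.
have -> : 1 - (q ^+ i * a / c) ^+ 2 * (q ^+ 2) ^+ j
  = (1 - q ^+ i * (a / c) * q ^+ j) * (1 - q ^+ i * - (a / c) * q ^+ j).
  by rewrite [(q ^+ 2) ^+ j]exprAC; field.
by rewrite mulf_neq0 // nonres_neq0 //; exact: nonres_shift.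
Qed.

(* The left-hand side of the theorem, with L = q^l and M = q^m. *)
Definition Phi a c L M n : F :=
  \sum_(k < n.+1) phi43_term a c (q ^+ n)^-1 (- (q * q ^+ n * a / (L * M * c)))
                    (q * a / (L * c)) (q * q ^+ n * a / M) (- c / q ^+ n) k.

(** * The well-poised case l = m = 0 *)

Definition theta a c n : F :=
  qpoch (q ^+ 2) (q * a) n * qpoch (q ^+ 2) (q ^+ 2 * a / c ^+ 2) n
  / (qpoch (q ^+ 2) q n * qpoch (q ^+ 2) (q ^+ 2 * a ^+ 2 / c ^+ 2) n).

(** The well-poised telescoping is summed over k <= n + 1, where the boundary term contains
    (q^{-n-1};q)_{n+2} = 0. *)
Lemma Phi_recr a c n : generic a c ->
  let Q := q ^+ n.+1 in
  Phi a c 1 1 n.+1 =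
  (1 - Q * a) * (Q + 1) * (c ^+ 2 - Q ^+ 2 * a)
    / ((c - Q * a) * (1 - Q ^+ 2 * a) * (Q + c)) * Phi a c 1 1 n.
Proof.
move=> gen Q; have [a0 c0 ha hc hcc hac hnac] := gen.
have Q0 : Q != 0 := expq_neq0 _.
have he k : qpoch q (q * a / c) k != 0.
  by apply: nonres_qpoch; rewrite -mulrA; exact: nonres_mulq.
have hf k : qpoch q (Q * a) k != 0 by apply: nonres_qpoch; exact: nonres_shift.
have hg k : qpoch q (- c / Q) k != 0 by apply: nonres_qpoch; exact: nonres_div.
have Q1 : 1 - Q != 0 by rewrite subr_eq0 eq_sym; exact: q_nonroot.
have cQa : c - Q * a != 0 := generic_sub_ac a c _ gen.
have Q2a : 1 - Q ^+ 2 * a != 0.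
  by rewrite -exprM; apply: nonres_sub; exact: nonres_shift.
have cQa' : c + Q * a != 0 := generic_add_ac a c _ gen.
have := wellpoised_telescope _ _ _ n.+1 a0 c0 Q0 he hf hg Q1 cQa Q2a cQa'.
rewrite (qpoch_vanish n.+1 n.+2) // /= !(mulr0, mul0r).
move/eqP; rewrite subr_eq0 => /eqP E.
have q0n := expq_neq0 n.
have qQ : q * Q^-1 = (q ^+ n)^-1 by rewrite /Q exprS; field; nonzero.
transitivity (\sum_(k < n.+2) phi43_term a c Q^-1 (q * (- Q * a / c)) (q * a / c)
               (q * (Q * a)) (- c / Q) k).
  by apply: eq_bigr => k _; congr (phi43_term _ _ _ _ _ _ _ _); rewrite /Q; field;
    nonzero.
(* The second series has upper parameter q^{-n}, so its term k = n + 1 vanishes, leaving the sum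
   over k <= n. *)
rewrite {}E; congr (_ * _); rewrite big_ord_recr /= qQ phi43_term_vanish // addr0.
by apply: eq_bigr => k _; congr (phi43_term _ _ _ _ _ _ _ _); rewrite /Q ?exprS;
  field; nonzero.
Qed.

(** Induction with the first-order recurrence [Phi_recr]. The quotient [theta], at n - j and with
    q^{l-i+j} a, q^{l-i} c for a, c, is the last factor of T_{i,j}. *)
Lemma Phi_theta a c n : generic a c ->
  qpoch q (q * q ^+ n * a) n * qpoch q (- q / c) n * Phi a c 1 1 n
  = qpoch q (q * q ^+ n) n * qpoch q (- q * a / c) n * theta a c n.
Proof.
move=> gen; elim: n => [|n IH].
  rewrite /Phi big_ord_recl big_ord0 /theta /phi43_term !qpoch0; field; nonzero.
have [a0 c0 ha hc hcc hac hnac] := gen.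
have nzW : qpoch q (q * q ^+ n * a) n * qpoch q (- q / c) n != 0.
  rewrite mulf_neq0 // nonres_qpoch //.
    by rewrite -mulrA; apply: nonres_mulq; exact: nonres_shift.
  by rewrite mulNr -mulrN -invrN; apply/nonres_mulq/nonres_inv; rewrite ?oppr_eq0.
have {IH} -> : Phi a c 1 1 n.+1 =
  (1 - q ^+ n.+1 * a) * (q ^+ n.+1 + 1) * (c ^+ 2 - (q ^+ n.+1) ^+ 2 * a)
  / ((c - q ^+ n.+1 * a) * (1 - (q ^+ n.+1) ^+ 2 * a) * (q ^+ n.+1 + c))
  * (qpoch q (q * q ^+ n) n * qpoch q (- q * a / c) n * theta a c n
     / (qpoch q (q * q ^+ n * a) n * qpoch q (- q / c) n)).
  by rewrite (Phi_recr _ _ n gen) -IH [X in _ = _ * X]mulrC mulKf.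
have y1 : 1 - q * q ^+ n * a != 0 by rewrite -exprS; apply: nonres_sub;
  exact: nonres_shift.
have y2 : 1 - q * q ^+ n != 0 by rewrite -exprS subr_eq0 eq_sym.
rewrite /theta.
(* The parameters q^{n+1} a and q^{n+1} depend on n themselves, so the step both shifts them by q
   and adds a factor. *)
have -> : q * q ^+ n.+1 * a = q * (q * q ^+ n * a) by rewrite exprS !mulrA.
have -> : q * q ^+ n.+1 = q * (q * q ^+ n) by rewrite exprS !mulrA.
rewrite (qpoch_shiftE _ _ y1) (qpoch_shiftE _ _ y2) !qpochS.
have q2n : (q ^+ 2) ^+ n = q ^+ n ^+ 2 by rewrite exprAC.
rewrite !q2n.
rewrite (exprS q n).
move: nzW.
set x := q ^+ n.
rewrite mulf_eq0 negb_or => /andP[].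
move=> W1 W2.
have aac : qpoch (q ^+ 2) (q ^+ 2 * a ^+ 2 / c ^+ 2) n != 0.
  by have := generic_qpoch2 a c 1 n gen; rewrite expr_div_n exprMn.
have := generic_add_ac a c n.+1 gen.
have := generic_sub_ac a c n.+1 gen.
have := generic_add_c a c n.+1 gen.
have := nonres_sub _ (nonres_shift _ (n.+1 * 2) ha); rewrite exprM.
have := qpoch2q_neq0 n.
have: 1 - q * x ^+ 2 != 0 by rewrite subr_eq0 eq_sym -exprM -exprS.
rewrite !(exprS q n) -/x => nz1 nz2 nz3 nz4 nz5 nz6.
have nz7 : c ^+ 2 - (q * a * x) ^+ 2 != 0.
  by rewrite subr_sqr (mulrAC q) mulf_neq0.
move: y1 y2 aac W1 W2 nz2; rewrite -/x.
move: (qpoch q (q * x * a) n) (qpoch q (- q / c) n) (qpoch q (q * x) n)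
  (qpoch q (- q * a / c) n) (qpoch _ _ _) (qpoch _ _ _) (qpoch _ _ _)
    (qpoch _ _ _) => *.
by field; nonzero.
Qed.

(** * Contiguous relation in m *)

Lemma phi43_termACA a0 a1 a2 a3 b1 b2 b3 k :
  phi43_term a0 a1 a2 a3 b1 b2 b3 k = phi43_term a0 a2 a1 a3 b2 b1 b3 k.
Proof.
by rewrite /phi43_term [_ * _ * qpoch _ a2 k]mulrAC [_ * _ * qpoch _ b2 k]mulrAC.
Qed.

(** The series at l = 0 divided by the second prefactor of the theorem. In this normalization
    [Phi_norm a c m n.+1] enters the relation in m with coefficient 1. *)
Definition Phi_norm a c m n : F :=
  qpoch q (q * q ^+ n * a / q ^+ m) n * qpoch q (- q / c) n
  / (qpoch q (q * q ^+ n / q ^+ m) n * qpoch q (- q * a / c) n)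
  * Phi a c 1 (q ^+ m) n.

Lemma qdiv_neq0 m n k : (m <= n)%N -> 1 - q * q ^+ n / q ^+ m * q ^+ k != 0.
Proof.
move=> mn; rewrite -(subnK mn) exprD mulrA mulfK // -exprS -exprD.
by rewrite subr_eq0 eq_sym addSn.
Qed.

Lemma solve_for (x y z s t u : F) : x != 0 -> x * s + y * t + z * u = 0 ->
  s = - (y * t + z * u) / x.
Proof.
move=> x0 /eqP; rewrite -addrA addr_eq0 => /eqP h.
by apply: (mulfI x0); rewrite h; field.
Qed.

Lemma qpow_sub_neq0 i j : (i < j)%N -> q ^+ j - q ^+ i != 0.
Proof.
move=> ij; rewrite -(subnK ij) addnS -addSn exprD -[X in _ - X]mul1r -mulrBl
  mulf_neq0 //.
by rewrite subr_eq0.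
Qed.

(** An instance of [contiguous_telescope] in which a and q^{-n-1} are shifted and c is the fixed
    upper parameter; shifting q^{-n-1} to q^{-n} is what lowers n. The lower parameter Q a / M
    belongs to m + 1, its shift by q to m. *)
Lemma Phi_norm_recm a c m n : generic a c -> (m <= n)%N ->
  let Q := q ^+ n.+1 in let M := q ^+ m in
  Phi_norm a c m.+1 n.+1 = Phi_norm a c m n.+1
   - q * M * Q * (Q ^+ 2 - 1) * (1 - a) * (c ^+ 2 - q * a)
     / ((c ^+ 2 - q ^+ 2 * a ^+ 2) * (Q ^+ 2 - q * M) * (Q ^+ 2 - M))
     * Phi_norm (q * a) c m n.
Proof.
move=> gen mn Q M; have [a0 c0 ha hc hcc hac hnac] := gen.
have Q0 : Q != 0 := expq_neq0 _.
have M0 : M != 0 := expq_neq0 _.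
have he k : qpoch q (Q * a / M) k != 0.
  by apply: nonres_qpoch; apply: nonres_div => //; exact: nonres_shift.
have hf k : qpoch q (q * a / c) k != 0.
  by apply: nonres_qpoch; rewrite -mulrA; exact: nonres_mulq.
have hg k : qpoch q (- c / Q) k != 0 by apply: nonres_qpoch; exact: nonres_div.
have a1 : 1 - a != 0 := nonres_sub _ ha.
have N1 : 1 - Q^-1 != 0.
  rewrite (_ : _ - _ = (Q - 1) / Q); last by field.
  by rewrite mulf_neq0 ?invr_eq0 // subr_eq0; exact: q_nonroot.
have Ni : Q^-1 != 0 by rewrite invr_eq0.
have bal : (Q * a / M) * (q * a / c) * (- c / Q)
  = q * a * Q^-1 * c * (- (Q * a / (M * c))).
  by field; nonzero.
have := contiguous_telescope _ _ _ _ _ _ _ n.+1 a0 Ni c0 bal he hf hg a1 N1.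
rewrite /= (qpoch_vanish n.+1 n.+2) // !(mulr0, mul0r).
have -> : \sum_(k < n.+2)
     phi43_term a Q^-1 c (- (Q * a / (M * c))) (Q * a / M) (q * a / c) (- c / Q) k
       = Phi a c 1 (q ^+ m.+1) n.+1.
  (* The contiguous relation lists q^{-n-1} before c, and two lower parameters accordingly; [Phi]
     has them in the other order. *)
  apply: eq_bigr => k _; rewrite phi43_termACA.
  by congr (phi43_term _ _ _ _ _ _ _ _); rewrite /Q /M ?exprS; field; nonzero.
have -> : \sum_(k < n.+2)
     phi43_term a Q^-1 c (q * - (Q * a / (M * c))) (q * (Q * a / M)) (q * a / c)
       (- c / Q) k = Phi a c 1 M n.+1.
  apply: eq_bigr => k _; rewrite phi43_termACA.
  by congr (phi43_term _ _ _ _ _ _ _ _); rewrite /Q /M ?exprS; field; nonzero.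
have -> : \sum_(k < n.+2)
     phi43_term (q * a) (q / Q) c (q * - (Q * a / (M * c))) (q * (Q * a / M))
       (q * (q * a / c)) (q * (- c / Q)) k = Phi (q * a) c 1 M n.
  have qn := expq_neq0 n.
  have qQ : q / Q = (q ^+ n)^-1 by rewrite /Q exprS; field; nonzero.
  (* The shifted upper parameter is q^{-n}, hence the term k = n + 1 is zero. *)
  rewrite big_ord_recr /= [X in _ + X]phi43_termACA qQ phi43_term_vanish // addr0.
  apply: eq_bigr => k _; rewrite phi43_termACA.
  by congr (phi43_term _ _ _ _ _ _ _ _); rewrite /Q /M ?exprS; field; nonzero.
have QM1 : Q ^+ 2 - M != 0.
  by rewrite -exprM qpow_sub_neq0 // muln2 -addnn ltn_addr // ltnS.
have QM2 : Q ^+ 2 - q * M != 0.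
  by rewrite -exprM -exprS qpow_sub_neq0 // muln2 -addnn addnS !ltnS (leq_trans mn)
    // leq_addl.
have MQa : M - Q * a != 0.
  rewrite (_ : _ - _ = M * (1 - Q * a / M)); last by field.
  by rewrite mulf_neq0 //; have := he 1; rewrite qpochS qpoch0 mul1r mulr1.
have alpha0 : (Q * a / M - a / Q) * (1 - Q * a / M) != 0.
  have -> : (Q * a / M - a / Q) * (1 - Q * a / M) = a * (Q ^+ 2 - M) * (M - Q * a) /
    (Q * M ^+ 2).
    by field; nonzero.
  by rewrite !mulf_neq0 ?invr_eq0 ?mulf_neq0.
move/(solve_for _ _ _ _ _ _ alpha0); rewrite /Phi_norm -/M -/Q => ->.
have ca1 := generic_sub_ac a c 1 gen.
have ca2 := generic_add_ac a c 1 gen.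
have Qc := generic_add_c a c n.+1 gen.
have Q1 : Q - 1 != 0 by rewrite subr_eq0; exact: q_nonroot.
have ca3 : c ^+ 2 - (q * a) ^+ 2 != 0 by rewrite subr_sqr mulf_neq0.
have Y1 : 1 - Q / M != 0.
  by have := qdiv_neq0 _ _ 0 mn; rewrite /Q /M exprS mulr1.
have Yn : 1 - Q / M * q ^+ n != 0.
  by have := qdiv_neq0 _ _ n mn; rewrite /Q /M exprS.
have YP : qpoch q (Q / M) n != 0.
  by apply/prodf_neq0 => k _; have := qdiv_neq0 _ _ k mn; rewrite /Q /M exprS.
have y1 : 1 - Q * a / M != 0 by have := he 1; rewrite qpochS qpoch0 mul1r mulr1.
have -> : q * Q * a / M = q * (Q * a / M) by rewrite -!mulrA.
have -> : q * Q * a / q ^+ m.+1 = Q * a / M by rewrite exprS -/M; field; nonzero.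
have -> : q * Q / M = q * (Q / M) by rewrite -!mulrA.
have -> : q * Q / q ^+ m.+1 = Q / M by rewrite exprS -/M; field; nonzero.
have -> : q * q ^+ n * (q * a) / M = q * (Q * a / M) by rewrite /Q exprS -!mulrA;
  congr (_ * _); rewrite mulrCA.
have -> : q * q ^+ n / M = Q / M by rewrite /Q exprS.
have -> : - q * (q * a) / c = q * (- q * a / c) by ring.
rewrite (qpochSl (Q * a / M)) (qpochS (q * (Q * a / M))).
rewrite (qpochS (Q / M)) (qpoch_shiftE _ _ Y1) (qpochS (- q / c)).
rewrite (qpochSl (- q * a / c)) (qpochS (Q / M)).
have xE : q ^+ n = Q / q by rewrite /Q exprS; field; nonzero.
have z1 : qpoch q (q * (- q * a / c)) n != 0.
  apply: nonres_qpoch; rewrite -mulrA mulNr -mulrN; do 2 apply: nonres_mulq.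
  by [].
have z2 : c - - q * a != 0 by rewrite mulNr opprK; exact: ca2.
have Yn' : q * M - Q ^+ 2 != 0 by rewrite -opprB oppr_eq0.
move: ca1 ca2 ca3 Qc Yn YP z1; rewrite -/Q xE.
move: (Phi a c 1 M n.+1) (Phi (q * a) c 1 M n) (qpoch q (q * (Q * a / M)) n)
  (qpoch q (- q / c) n) (qpoch q (Q / M) n) (qpoch q _ n) => *.
have w1 : M - Q != 0.
  by have := sub_div_neq0 Q M 1 M0; rewrite !mulr1; apply.
have w2 : M - Q * Q != 0 by rewrite -opprB oppr_eq0.
have w3 : M * q - Q * Q != 0 by rewrite mulrC.
have w4 : Q * a * Q + - a * M != 0.
  by rewrite (_ : _ + _ = a * (Q ^+ 2 - M)) ?mulf_neq0 //; ring.
by field; nonzero.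
Qed.

(** The exponents i + l - N with l < k are all negative. This covers the lower parameters q^{m-2n}
    and q^{j-2n-1} of T_{i,j}. *)
Lemma qpoch_ratio_neq0 i N k : (i + k <= N)%N -> qpoch q (q ^+ i / q ^+ N) k != 0.
Proof.
move=> ikN; apply/prodf_neq0 => -[l lk] _ /=.
have lN : (i + l < N)%N by apply: leq_trans ikN; rewrite ltn_add2l.
rewrite mulrAC -exprD (_ : 1 - _ = (q ^+ N - q ^+ (i + l)) / q ^+ N); last by field.
by rewrite mulf_neq0 ?invr_eq0 // qpow_sub_neq0.
Qed.

(** * Expansion in m *)

(** The factors of T_{i,j} that involve j, apart from [theta], with a and c in place of q^{l-i} a
    and q^{l-i} c. *)
Definition Dcoef a c m n j : F :=
  q ^+ 'C(j.+1, 2) * (q ^+ m / q ^+ n) ^+ j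
  * (qpoch q (q ^+ m)^-1 j * qpoch q (q ^+ n)^-1 j * qpoch q (- (q ^+ n)^-1) j
     * qpoch q a j * qpoch q (q * a / c ^+ 2) j)
  / (qpoch q q j * qpoch q (q * a / c) j * qpoch q (- q * a / c) j
     * qpoch q (q ^+ m / q ^+ n.*2) j * qpoch q (q ^+ j / q ^+ (n.*2).+1) j).

(** The relation of [Phi_norm_recm] read off on the coefficients of the expansion: the term at (q a,
    n) has its index j raised by one. Once all factorials have length j, it is a rational identity
    in q, q^j, M, Q, a and c. *)
Lemma Dcoef_rec a c m n j : generic a c -> (j <= m)%N -> (m <= n)%N ->
  let Q := q ^+ n.+1 in let M := q ^+ m in
  Dcoef a c m.+1 n.+1 j.+1 = Dcoef a c m n.+1 j.+1
   - q * M * Q * (Q ^+ 2 - 1) * (1 - a) * (c ^+ 2 - q * a)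
     / ((c ^+ 2 - q ^+ 2 * a ^+ 2) * (Q ^+ 2 - q * M) * (Q ^+ 2 - M))
     * Dcoef (q * a) c m n j.
Proof.
move=> gen jm mn Q M; have [a0 c0 ha hc hcc hac hnac] := gen.
have Q0 : Q != 0 := expq_neq0 _.
have M0 : M != 0 := expq_neq0 _.
pose x := q ^+ j.
have x0 : x != 0 := expq_neq0 j.
have nE : q ^+ n = Q / q by rewrite /Q exprS; field; nonzero.
have n2E : q ^+ n.*2 = (Q / q) ^+ 2 by rewrite -muln2 exprM nE.
have N2E : q ^+ n.+1.*2 = Q ^+ 2 by rewrite -muln2 exprM.
have qs1 : 1 - q * (M / Q ^+ 2) != 0.
  rewrite (_ : _ - _ = (Q ^+ 2 - q * M) / Q ^+ 2); last by field.
  rewrite mulf_neq0 ?invr_eq0 ?expf_neq0 // -exprM -exprS qpow_sub_neq0 //.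
  by rewrite muln2 -addnn addnS !ltnS (leq_trans mn) // leq_addl.
have qsx : 1 - q * (M / Q ^+ 2) * x != 0.
  rewrite (_ : _ - _ = (Q ^+ 2 - q * M * x) / Q ^+ 2); last by field.
  rewrite mulf_neq0 ?invr_eq0 ?expf_neq0 // -exprM -exprS -exprD qpow_sub_neq0 //.
  by rewrite muln2 -addnn addnS !ltnS leq_add // (leq_trans jm).
have sP : qpoch q (q * (q * (M / Q ^+ 2))) j != 0.
  have -> : q * (q * (M / Q ^+ 2)) = q ^+ m / q ^+ n.*2 by rewrite n2E -/M; field;
    nonzero.
  by apply: qpoch_ratio_neq0; rewrite -addnn leq_add // (leq_trans jm).
have tP : qpoch q (q * (x / Q ^+ 2)) j != 0.
  have -> : q * (x / Q ^+ 2) = q ^+ j / q ^+ n.*2.+1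
    by rewrite (exprS q n.*2) n2E -/x; field; nonzero.
  by apply: qpoch_ratio_neq0; rewrite -addnn leqW // leq_add // (leq_trans jm).
rewrite /Dcoef N2E n2E nE -/M -/Q.
have -> : q ^+ m.+1 = q * M by rewrite exprS.
have -> : q ^+ j.+1 / q ^+ n.+1.*2.+1 = x / Q ^+ 2 by rewrite (exprS q j)
  (exprS q n.+1.*2) N2E -/x; field; nonzero.
have -> : q ^+ j / q ^+ n.*2.+1 = q * (x / Q ^+ 2) by rewrite (exprS q n.*2) n2E -/x;
  field; nonzero.
have -> : M / (Q / q) ^+ 2 = q * (q * (M / Q ^+ 2)) by field; nonzero.
have -> : (q * M) / Q ^+ 2 = q * (M / Q ^+ 2) by rewrite mulrA.
(* With s = M / Q^2 the three coefficients carry factorials of q s, s and q^2 s; all are reduced to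
   (q^2 s;q)_j. *)
rewrite (qpochSl (M / Q ^+ 2))
  (qpochSl (q * (M / Q ^+ 2))) -(mulfK qsx (qpoch q (q * (M / Q ^+ 2)) j)).
rewrite -(qpoch_shift (q * (M / Q ^+ 2)) j).
rewrite (qpochSl (x / Q ^+ 2)) (qpochSl (q * M)^-1) (qpochSl Q^-1) (qpochSl (- Q^-1))
  (qpochSl a).
rewrite (qpochSl (q * a / c ^+ 2)) (qpochSl (q * a / c)) (qpochSl (- q * a / c))
  (qpochS M^-1) (qpochS q).
have -> : q * (q * M)^-1 = M^-1 by field; nonzero.
have -> : (Q / q)^-1 = q * Q^-1 by field; nonzero.
have -> : - (q * Q^-1) = q * - Q^-1 by rewrite mulrN.
have -> : q * (q * a) / c ^+ 2 = q * (q * a / c ^+ 2) by rewrite !mulrA.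
have -> : q * (q * a) / c = q * (q * a / c) by rewrite !mulrA.
have -> : - q * (q * a) / c = q * (- q * a / c) by ring.
have -> : q ^+ 'C(j.+2, 2) = q ^+ 'C(j.+1, 2) * (q * x)
  by rewrite -exprS -exprD binS bin1.
rewrite !(exprS _ j) !exprMn -/x.
have ca1 : c - q * a != 0 := generic_sub_ac a c 1 gen.
have ca2 : c + q * a != 0 := generic_add_ac a c 1 gen.
have ca3 : c ^+ 2 - (q * a) ^+ 2 != 0 by rewrite subr_sqr mulf_neq0.
have ca4 : c - - q * a != 0 by rewrite mulNr opprK.
have acP : qpoch q (q * (q * a / c)) j != 0.
  by apply: nonres_qpoch; rewrite -mulrA; do 2 apply: nonres_mulq.
have acN : qpoch q (q * (- q * a / c)) j != 0.
  by apply: nonres_qpoch; rewrite -mulrA mulNr -mulrN; do 2 apply: nonres_mulq.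
have qP := qpochq_neq0 j.
have qx : 1 - q * x != 0 by rewrite -exprS subr_eq0 eq_sym.
have QM1 : Q ^+ 2 - M != 0.
  by rewrite -exprM qpow_sub_neq0 // muln2 -addnn ltn_addr // ltnS.
have QM2 : Q ^+ 2 - q * M != 0.
  by rewrite -exprM -exprS qpow_sub_neq0 // muln2 -addnn addnS !ltnS (leq_trans mn)
    // leq_addl.
have Qx : Q ^+ 2 - x != 0.
  by rewrite -exprM qpow_sub_neq0 // muln2 -addnn ltn_addr // ltnS (leq_trans jm).
have QMx : Q ^+ 2 - q * M * x != 0.
  rewrite -exprM -exprS -exprD qpow_sub_neq0 //.
  by rewrite muln2 -addnn addnS !ltnS leq_add // (leq_trans jm).
move: sP tP acP acN qP.
move: (qpoch q _ j) (qpoch q _ j) (qpoch q _ j) (qpoch q _ j) (qpoch q _ j)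
  (qpoch q _ j)
  (qpoch q _ j) (qpoch q _ j) (qpoch q _ j) (qpoch q _ j) (Q^-1 ^+ j) (M ^+ j)
    (q ^+ 'C(j.+1, 2)) => *.
by field; nonzero.
Qed.

Lemma Dcoef0 a c m n : Dcoef a c m n 0 = 1.
Proof. by rewrite /Dcoef bin_small // !qpoch0 !expr0 !mulr1 divr1. Qed.

Lemma Dcoef_vanish a c m n j : (m < j)%N -> Dcoef a c m n j = 0.
Proof. by move=> mj; rewrite /Dcoef qpoch_vanish // !(mulr0, mul0r). Qed.

(** Induction on m: both terms of [Phi_norm_recm] are expanded, the second sum is shifted by one in
    j, and [Dcoef_rec] compares the coefficients. *)
Lemma Phi_norm_sum a c m n : generic a c -> (m <= n)%N ->
  Phi_norm a c m n = \sum_(j < m.+1) Dcoef a c m n j * theta (q ^+ j * a) c (n - j).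
Proof.
elim: m n a => [|m IH] n a gen mn.
  rewrite big_ord_recl big_ord0 addr0 Dcoef0 !mul1r subn0 /Phi_norm expr0 !divr1.
  have W0 : qpoch q (q * q ^+ n) n * qpoch q (- q * a / c) n != 0.
    rewrite mulf_neq0 //.
      by apply/prodf_neq0 => k _; rewrite -exprS -exprD subr_eq0 eq_sym addSn.
    apply: nonres_qpoch; rewrite -mulrA mulNr -mulrN; apply: nonres_mulq.
    exact: nonres_Nac gen.
  by rewrite mulrAC Phi_theta // mulrAC mulfV // mul1r.
case: n mn => // n; rewrite ltnS => mn.
rewrite Phi_norm_recm // IH // ?leqW //; set B := _ / _.
rewrite IH //; last by have := generic_shift a c 1 0 gen; rewrite mul1r.
rewrite [RHS]big_ord_recl [in RHS]Dcoef0.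
(* The first sum is extended by the term j = m + 1, whose coefficient is zero. *)
have -> : \sum_(j < m.+1) Dcoef a c m n.+1 j * theta (q ^+ j * a) c (n.+1 - j)
  = \sum_(j < m.+2) Dcoef a c m n.+1 j * theta (q ^+ j * a) c (n.+1 - j).
  by rewrite [RHS]big_ord_recr /= Dcoef_vanish // mul0r addr0.
(* The term j = 0 comes from the first sum alone, with coefficient 1 on both sides. *)
rewrite [X in X - _]big_ord_recl [in LHS]Dcoef0 -addrA; congr (_ + _).
rewrite mulr_sumr -sumrB; apply: eq_bigr => j _.
rewrite !lift0 Dcoef_rec // -1?ltnS // subSS -/B mulrBl.
by rewrite -!mulrA (mulrA _ q a) -exprSr.
Qed.

(** * Contiguous relation in l *)

Lemma generic_subc a c : generic a c -> 1 - c != 0.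
Proof.
move=> gen; have := nonres_sub _ (nonres_cc _ _ gen).
by rewrite -[1](expr1n _ 2) subr_sqr mulf_eq0 negb_or expr1n => /andP[].
Qed.

Lemma generic_sub_Lca a c l : generic a c -> q ^+ l * c - a != 0.
Proof.
case=> a0 c0 _ _ _ hac _.
rewrite (_ : _ - _ = q ^+ l * c * (1 - a / c / q ^+ l)); last by field; nonzero.
by rewrite !mulf_neq0 ?nonres_sub //; exact: nonres_div.
Qed.

Lemma generic_sub_Lcc a c l : generic a c -> 1 - q ^+ l * c ^+ 2 != 0.
Proof. by case=> _ _ _ _ hcc _ _; apply: nonres_sub; exact: nonres_shift. Qed.

(** Only the denominator of the second prefactor is cleared. Its numerator (q^{1-m+n}, -qa/c;q)_n
    depends on a and c through a/c, so it is the same for (a, c) and (qa, qc) and can stay outside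
    the relation in l. *)
Definition Psi a c l m n : F :=
  qpoch q (q * q ^+ n * a / q ^+ m) n * qpoch q (- q / c) n
  * Phi a c (q ^+ l) (q ^+ m) n.

(** An instance of [contiguous_telescope] with a and c shifted and q^{-n} fixed. The lower parameter
    a / (L c) belongs to l + 1, its shift by q to l; the boundary term contains (q^{-n};q)_{n+1} =
    0. *)
Lemma Psi_recl a c l m n : generic a c ->
  let L := q ^+ l in
  Psi a c l.+1 m n
  = L * c * (1 - a) * (1 - c) / ((1 - L * c ^+ 2) * (L * c - a)) * Psi (q * a)
    (q * c) l m n
  + (1 - L * c) * (L * c ^+ 2 - a) / ((1 - L * c ^+ 2) * (L * c - a)) * Psi a c l m n.
Proof.
move=> gen L; have [a0 c0 ha hc hcc hac hnac] := gen.
pose Q := q ^+ n; pose M := q ^+ m.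
have Q0 : Q != 0 := expq_neq0 _.
have M0 : M != 0 := expq_neq0 _.
have L0 : L != 0 := expq_neq0 _.
have Ni : Q^-1 != 0 by rewrite invr_eq0.
have he k : qpoch q (a / (L * c)) k != 0.
  by apply: nonres_qpoch; rewrite invfM mulrCA mulrC; exact: nonres_div.
have hf k : qpoch q (q * Q * a / M) k != 0.
  by apply: nonres_qpoch; apply: nonres_div; rewrite -exprS; exact: nonres_shift.
have hg k : qpoch q (- c / Q) k != 0 by apply: nonres_qpoch; exact: nonres_div.
have a1 := nonres_sub _ ha.
have c1 := generic_subc _ _ gen.
have bal : (a / (L * c)) * (q * Q * a / M) * (- c / Q)
  = q * a * c * Q^-1 * (- (Q * a / (L * M * c))).
  by field; nonzero.
have := contiguous_telescope _ _ _ _ _ _ _ n a0 c0 Ni bal he hf hg a1 c1.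
rewrite /= (qpoch_vanish n n.+1) // !(mulr0, mul0r).
have -> : \sum_(k < n.+1)
     phi43_term a c Q^-1 (- (Q * a / (L * M * c))) (a / (L * c)) (q * Q * a / M)
       (- c / Q) k = Phi a c (q ^+ l.+1) M n.
  by apply: eq_bigr => k _; congr (phi43_term _ _ _ _ _ _ _ _);
    rewrite /L /M /Q ?(exprS q l); field; nonzero.
have -> : \sum_(k < n.+1)
     phi43_term a c Q^-1 (q * - (Q * a / (L * M * c))) (q * (a / (L * c)))
       (q * Q * a / M) (- c / Q) k = Phi a c L M n.
  by apply: eq_bigr => k _; congr (phi43_term _ _ _ _ _ _ _ _); rewrite /L /M /Q;
    field; nonzero.
have -> : \sum_(k < n.+1)
     phi43_term (q * a) (q * c) Q^-1 (q * - (Q * a / (L * M * c)))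
       (q * (a / (L * c))) (q * (q * Q * a / M)) (q * (- c / Q)) k = Phi (q * a)
         (q * c) L M n.
  by apply: eq_bigr => k _; congr (phi43_term _ _ _ _ _ _ _ _); rewrite /L /M /Q;
    field; nonzero.
have Lcc := generic_sub_Lcc a c l gen.
have Lca := generic_sub_Lca a c l gen.
have alpha0 : (a / (L * c) - a * c) * (1 - a / (L * c)) != 0.
  have -> : (a / (L * c) - a * c) * (1 - a / (L * c))
    = a * (1 - L * c ^+ 2) * (L * c - a) / (L * c) ^+ 2.
    by field; nonzero.
  by rewrite !mulf_neq0 ?invr_eq0 ?expf_neq0 ?mulf_neq0.
move/(solve_for _ _ _ _ _ _ alpha0); rewrite /Psi -/M -/Q -/L => ->.
have y1 : 1 - q * Q * a / M != 0 by have := hf 1; rewrite qpochS qpoch0 mul1r mulr1.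
have c2 : 1 + c != 0.
  by have := nonres_sub _ hc; rewrite opprK.
have c3 : 1 - - 1 / c != 0.
  by rewrite (_ : _ - _ = (1 + c) / c) ?mulf_neq0 ?invr_eq0 //; field.
have Qc := generic_add_c a c n gen.
have -> : q * Q * (q * a) / M = q * (q * Q * a / M) by ring.
have -> : - q / (q * c) = - 1 / c by field; nonzero.
have -> : - q / c = q * (- 1 / c) by ring.
rewrite (qpoch_shiftE _ _ y1) (qpoch_shiftE _ _ c3).
move: Qc Lcc Lca y1; rewrite -/Q -/L.
move: (Phi a c L M n) (Phi (q * a) (q * c) L M n) (qpoch q _ n) (qpoch q _ n) => *.
have c4 : c + 1 != 0 by rewrite addrC.
have y2 : M - q * Q * a != 0.
  by have := sub_div_neq0 (q * Q * a) M 1 M0; rewrite !mulr1; apply.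
have Lcc2 : a + - (a * c) * (L * c) != 0.
  by rewrite (_ : _ + _ = a * (1 - L * c ^+ 2)) ?mulf_neq0 //; ring.
by field; nonzero.
Qed.

(** * Expansion in l *)

(** The first prefactor of the theorem times the factors of T_{i,j} that involve i but not j. *)
Definition Ccoef a c l i : F :=
  qpoch q a l * qpoch q c l / (qpoch q (q ^+ l * c ^+ 2 / q) l * qpoch q
    (q * a / (q ^+ l * c)) l)
  * (q ^+ l) ^+ i * (c / a) ^+ i
  * ((1 - q * (q ^+ i) ^+ 2 / ((q ^+ l) ^+ 2 * c ^+ 2)) /
    (1 - q / ((q ^+ l) ^+ 2 * c ^+ 2)))
  * (qpoch q (q ^+ l)^-1 i * qpoch q (q * a / (q ^+ l * c ^+ 2)) i
     * qpoch q (q / ((q ^+ l) ^+ 2 * c ^+ 2)) i)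
  / (qpoch q q i * qpoch q (q / (q ^+ l * a)) i * qpoch q
    (q ^+ 2 / (q ^+ l * c ^+ 2)) i).

Lemma Ccoef_vanish a c l i : (l < i)%N -> Ccoef a c l i = 0.
Proof. by move=> li; rewrite /Ccoef qpoch_vanish // !(mulr0, mul0r). Qed.

(** In the expansion of [Psi] the index i goes with (q^{l-i} a, q^{l-i} c). From l to l + 1 the
    shifted term of [Psi_recl] therefore keeps i and the unshifted one raises it by one; this is the
    resulting rule for the coefficients. *)
Lemma Ccoef_rec a c l i : generic a c ->
  let L := q ^+ l in
  Ccoef a c l.+1 i.+1
  = L * c * (1 - a) * (1 - c) / ((1 - L * c ^+ 2) * (L * c - a)) * Ccoef (q * a)
    (q * c) l i.+1
  + (1 - L * c) * (L * c ^+ 2 - a) / ((1 - L * c ^+ 2) * (L * c - a)) * Ccoef a c l i.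
Proof.
move=> gen L; have [a0 c0 ha hc hcc hac hnac] := gen.
pose x := q ^+ i.
have L0 : L != 0 := expq_neq0 l.
have x0 : x != 0 := expq_neq0 i.
have hcci : nonres (c ^+ 2)^-1 by apply: nonres_inv => //; rewrite expf_neq0.
have hai : nonres a^-1 by exact: nonres_inv.
have a1 := nonres_sub _ ha.
have c1 := generic_subc _ _ gen.
have Lcc := generic_sub_Lcc a c l gen.
have Lca := generic_sub_Lca a c l gen.
(* Up to powers of q the parameters of the three coefficients agree; w, v, s and u are
   representatives. *)
pose w := L * c ^+ 2 / q; pose v := a / (L * c ^+ 2);
  pose s := (q * L ^+ 2 * c ^+ 2)^-1; pose u := (L * c ^+ 2)^-1.
have nw : nonres w by apply: (nonres_div _ 1); exact: nonres_shift.
have nu : nonres u by rewrite /u invfM mulrC; exact: nonres_div.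
have ns : nonres s.
  have -> : s = (c ^+ 2)^-1 / q ^+ (1 + l.*2) by rewrite exprD -muln2 exprM /s -/L;
    field; nonzero.
  exact: nonres_div.
have nq x1 : nonres x1 -> nonres (q * x1) := nonres_mulq x1.
rewrite /Ccoef.
have -> : q ^+ l.+1 = q * L by rewrite exprS.
have -> : q ^+ i.+1 = q * x by rewrite exprS.
rewrite -/L -/x.
have -> : (q * L) * c ^+ 2 / q = q * w by rewrite /w; field; nonzero.
have -> : L * (q * c) ^+ 2 / q = q * (q * w) by rewrite /w; field; nonzero.
rewrite -/w.
have -> : q * (q * a) / (L * (q * c)) = q * (a / (L * c)) by field; nonzero.
have -> : q * a / (q * L * c) = a / (L * c) by field; nonzero.
have -> : q * a / (L * c) = q * (a / (L * c)) by field; nonzero.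
have -> : q * c / (q * a) = c / a by field; nonzero.
have -> : q * a / (q * L * c ^+ 2) = v by rewrite /v; field; nonzero.
have -> : q * (q * a) / (L * (q * c) ^+ 2) = v by rewrite /v; field; nonzero.
have -> : q * a / (L * c ^+ 2) = q * v by rewrite /v; field; nonzero.
have -> : q / ((q * L) ^+ 2 * c ^+ 2) = s by rewrite /s; field; nonzero.
have -> : q / (L ^+ 2 * (q * c) ^+ 2) = s by rewrite /s; field; nonzero.
have -> : q / (L ^+ 2 * c ^+ 2) = q * (q * s) by rewrite /s; field; nonzero.
have -> : q / (q * L * a) = (L * a)^-1 by field; nonzero.
have -> : q / (L * (q * a)) = (L * a)^-1 by field; nonzero.
have -> : q ^+ 2 / (q * L * c ^+ 2) = q * u by rewrite /u; field; nonzero.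
have -> : q ^+ 2 / (L * (q * c) ^+ 2) = u by rewrite /u; field; nonzero.
have -> : q ^+ 2 / (L * c ^+ 2) = q * (q * u) by rewrite /u; field; nonzero.
have w1 := nonres_sub _ nw; have w2 := nonres_sub _ (nq _ nw).
have qsx := nonres_neq0 _ i (nq _ ns).
have qux := nonres_neq0 _ i (nq _ nu).
rewrite (qpochS a) (qpochS c) (qpoch_shiftE _ _ a1) (qpoch_shiftE _ _ c1)
  (qpochS (q * w)).
rewrite (qpoch_shiftE _ _ w2) (qpoch_shiftE _ _ w1) (qpochSl (a / _)).
rewrite (qpochSl (q * L)^-1) (qpochS L^-1) (qpochSl v) (qpochSl s) (qpochS q).
rewrite (qpochSl (L * a)^-1) (qpochSl (q * u)) (qpochSl u).
(* (q s;q)_i and (q u;q)_i are turned into (q^2 s;q)_i and (q^2 u;q)_i, the forms occurring in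
   [Ccoef a c l i]. *)
rewrite -(mulfK qsx (qpoch q (q * s) i)) -(qpoch_shift (q * s) i).
rewrite -(mulfK qux (qpoch q (q * u) i)) -(qpoch_shift (q * u) i).
rewrite -/L -/x !(exprS _ i).
have -> : q * (q * L)^-1 = L^-1 by field; nonzero.
have wP : qpoch q w l != 0 by exact: nonres_qpoch.
have acP : qpoch q (q * (a / (L * c))) l != 0.
  have -> : a / (L * c) = a / c / L by field; nonzero.
  by apply: nonres_qpoch; apply: nq; exact: nonres_div.
have qP := qpochq_neq0 i.
have aP : qpoch q (q * (L * a)^-1) i != 0.
  by apply: nonres_qpoch; apply: nq; rewrite invfM mulrC; exact: nonres_div.
have uP : qpoch q (q * (q * u)) i != 0 by exact: (nonres_qpoch _ _ (nq _ (nq _ nu))).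
move: wP acP qP aP uP.
move: (qpoch q _ i) (qpoch q _ i) (qpoch q _ i) (qpoch q _ i) (qpoch q _ i)
  (qpoch q _ i)
  (qpoch q _ l) (qpoch q _ l) (qpoch q _ l) (qpoch q _ l) => *.
rewrite exprMn; move: (L ^+ i) ((c / a) ^+ i) => *.
move: qsx qux w1 w2; rewrite /s /u /v /w -/x => *.
(* Up to sign, this is the form of the denominators left for [field] that involve c but not a. *)
have cc j k : q ^+ j * c ^+ 2 - q ^+ k != 0.
  by rewrite subr_eq0 mulrC; exact: hcc.
have L2 : q ^+ (l * 2) = L ^+ 2 by rewrite exprM.
have := cc (l * 2)%N 1%N; rewrite L2 -exprMn => n1.
have n2 : L * c ^+ 2 - q * x != 0 by rewrite -exprS; exact: cc.
have n3 : L * c ^+ 2 - q != 0 := cc l 1%N.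
have n4 : L * c ^+ 2 - 1 != 0 := cc l 0%N.
have n5 : L * a - 1 != 0 by rewrite subr_eq0 mulrC; exact: (ha l 0%N).
have n6 : 1 - q * x != 0 by rewrite -exprS subr_eq0 eq_sym.
have := cc (l * 2)%N i; rewrite L2 -exprMn -/x => n7.
have := cc (l * 2).+1 0%N; rewrite exprS L2 => n8.
have n9 : q - L * c ^+ 2 != 0 by rewrite -opprB oppr_eq0.
have := cc (l * 2)%N 0%N; rewrite L2 => n10.
have n11 : 1 - L * c ^+ 2 * L != 0 by rewrite mulrAC -opprB oppr_eq0.
have n12 : q - L * c ^+ 2 * L != 0 by rewrite mulrAC -opprB oppr_eq0 -expr2 -exprMn.
by field; nonzero.
Qed.

(** The unshifted term of [Psi_recl] starts at index 1, so only the shifted one contributes to i =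
    0. *)
Lemma Ccoef_rec0 a c l : generic a c ->
  let L := q ^+ l in
  Ccoef a c l.+1 0
  = L * c * (1 - a) * (1 - c) / ((1 - L * c ^+ 2) * (L * c - a)) * Ccoef (q * a)
    (q * c) l 0.
Proof.
move=> gen L; have [a0 c0 ha hc hcc hac hnac] := gen.
have L0 : L != 0 := expq_neq0 l.
have a1 := nonres_sub _ ha.
have c1 := generic_subc _ _ gen.
have Lcc := generic_sub_Lcc a c l gen.
have Lca := generic_sub_Lca a c l gen.
rewrite /Ccoef !qpoch0 !expr0 exprS -/L.
have -> : (q * L) * c ^+ 2 / q = L * c ^+ 2 by field; nonzero.
have -> : L * (q * c) ^+ 2 / q = q * (L * c ^+ 2) by field; nonzero.
have -> : q * (q * a) / (L * (q * c)) = q * (a / (L * c)) by field; nonzero.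
have -> : q * a / (q * L * c) = a / (L * c) by field; nonzero.
have -> : q / (L ^+ 2 * (q * c) ^+ 2) = (q * L ^+ 2 * c ^+ 2)^-1 by field; nonzero.
have -> : q / ((q * L) ^+ 2 * c ^+ 2) = (q * L ^+ 2 * c ^+ 2)^-1 by field; nonzero.
rewrite !(qpochSl _ l).
have wP : qpoch q (q * (L * c ^+ 2)) l != 0.
  by apply: nonres_qpoch; apply: nonres_mulq; exact: nonres_shift.
have acP : qpoch q (q * (a / (L * c))) l != 0.
  have -> : a / (L * c) = a / c / L by field; nonzero.
  by apply: nonres_qpoch; apply: nonres_mulq; exact: nonres_div.
have n1 : q * L ^+ 2 * c ^+ 2 - 1 != 0.
  rewrite (_ : q * L ^+ 2 = q ^+ (l * 2).+1); last by rewrite (exprS q (l * 2)) exprM.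
  by rewrite subr_eq0 mulrC; exact: (hcc _ 0%N).
move: wP acP; move: (qpoch q _ l) (qpoch q _ l) (qpoch q _ l) (qpoch q _ l) => *.
by field; nonzero.
Qed.

(** Induction on l with [Psi_recl], the sum from the unshifted term being moved by one in i. *)
Lemma Psi_sum a c l m n : generic a c ->
  Psi a c l m n = \sum_(i < l.+1) Ccoef a c l i * Psi (q ^+ (l - i) * a)
    (q ^+ (l - i) * c) 0 m n.
Proof.
elim: l a c => [|l IH] a c gen.
  rewrite big_ord_recl big_ord0 addr0 subn0 !mul1r.
  have [a0 c0 _ _ hcc _ _] := gen.
  (* For l = 0 the coefficient contains (1 - q/c^2)/(1 - q/c^2), which is 1 only if c^2 differs from
     q. *)
  have n1 : c ^+ 2 - q != 0 by rewrite subr_eq0 -[c ^+ 2]mulr1; exact: (hcc 0%N 1%N).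
  by rewrite /Ccoef !qpoch0 !expr0; field; nonzero.
have gen1 := generic_shift a c 1 1 gen.
have sh k y : q ^+ k * (q * y) = q ^+ k.+1 * y by rewrite mulrA -exprSr.
rewrite Psi_recl //; set A := _ / _; set B := _ / _.
rewrite !IH //.
rewrite [RHS]big_ord_recl [in RHS]Ccoef_rec0 // -/A.
rewrite [X in A * X + _]big_ord_recl mulrDr !subn0 -addrA; congr (_ + _).
  by rewrite -mulrA !sh.
under [RHS]eq_bigr => i _ do rewrite lift0 Ccoef_rec // -/A -/B subSS mulrDl.
rewrite big_split /=; congr (_ + _); last by rewrite mulr_sumr;
  apply: eq_bigr => i _; rewrite mulrA.
(* In the sum from the shifted term the coefficient of index l + 1 is zero. *)
rewrite [RHS]big_ord_recr /= Ccoef_vanish // mulr0 mul0r addr0.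
rewrite mulr_sumr; apply: eq_bigr => i _; rewrite /bump /= add1n.
by rewrite -mulrA !sh subnSK.
Qed.

(** * The identity for generic parameters *)

Lemma expz_linE (i j k : nat) (z : int) : z = i%:Z - j%:Z + k%:Z -> q ^ z
  = q ^+ i / q ^+ j * q ^+ k.
Proof. by move=> ->; rewrite !expfzDr // -exprnN. Qed.

(** Up to powers of q^j and q, the factors of T_{i,j} that involve j contain a and c only through
    q^{l-i} a, q^{i-l} a/c^2 and a/c, that is through the pair (q^{l-i} a, q^{l-i} c); so the double
    expansion matches the summand. *)
Lemma Tterm_E a c l m n i j : generic a c -> (i <= l)%N -> (j <= m)%N -> (m <= n)%N ->
  qpochs q [:: a; c] l / qpochs q [:: q ^ (l%:Z - 1) * c ^+ 2; q ^ (1 - l%:Z) * a / c] l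
  * Tterm q a c l m n i j
  = Ccoef a c l i * Dcoef (q ^+ (l - i) * a) (q ^+ (l - i) * c) m n j
    * theta (q ^+ j * (q ^+ (l - i) * a)) (q ^+ (l - i) * c) (n - j).
Proof.
move=> gen il jm mn; have [a0 c0 ha hc hcc hac hnac] := gen.
have E : q ^+ l = q ^+ (l - i) * q ^+ i by rewrite -exprD subnK.
rewrite /Tterm !qpochs_cons !qpochs_nil !mulr1.
have -> : q ^ (l%:Z * i%:Z + (m%:Z - n%:Z) * j%:Z + 'C(j.+1, 2)%:Z)
  = (q ^+ l) ^+ i * (q ^+ m / q ^+ n) ^+ j * q ^+ 'C(j.+1, 2).
  by rewrite mulrBl -!PoszM addrA !expfzDr // -exprnN -[q ^ Posz _]/(q ^+ _)
    -[q ^ Posz (m * j)]/(q ^+ _) !exprM expr_div_n !mulrA.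
(* Integer powers become quotients of natural powers, on which [field] and [ring] operate. *)
rewrite (@expz_linE l 1 0 (l%:Z - 1)) ?addr0 //.
rewrite (@expz_linE 1 l 0 (1 - l%:Z)) ?addr0 //.
rewrite (@expz_linE 1 (2 * l)%N (2 * i)%N (1 - 2 * l%:Z + 2 * i%:Z)) ?PoszM //.
rewrite (@expz_linE 1 (2 * l)%N 0 (1 - 2 * l%:Z)) ?PoszM ?addr0 //.
rewrite (@expz_linE 0 l 0 (- l%:Z)) ?addr0 ?sub0r //.
rewrite (@expz_linE 2 l 0 (2 - l%:Z)) ?addr0 //.
rewrite (@expz_linE 0 m 0 (- m%:Z)) ?addr0 ?sub0r //.
rewrite (@expz_linE 0 n 0 (- n%:Z)) ?addr0 ?sub0r //.
rewrite (@expz_linE l i 0 (l%:Z - i%:Z)) ?addr0 //.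
rewrite (@expz_linE 1 l i (1 - l%:Z + i%:Z)) //.
rewrite (@expz_linE m (2 * n)%N 0 (m%:Z - 2 * n%:Z)) ?PoszM ?addr0 //.
rewrite (@expz_linE j (2 * n).+1%N 0 (j%:Z - 2 * n%:Z - 1)); last first.
  by rewrite intS PoszM; ring.
rewrite (@expz_linE l.+1 i j (1 + l%:Z - i%:Z + j%:Z)) //.
rewrite (@expz_linE 2 l (i + j)%N (2 - l%:Z + i%:Z + j%:Z)); last first.
  by rewrite PoszD addrA.
rewrite /Ccoef /Dcoef /theta !expr0 !expr1 !mul1r !mulr1 !mul2n.
pose x := q ^+ i; pose y := q ^+ j; pose z := q ^+ (l - i).
have x0 : x != 0 := expq_neq0 i.
have y0 : y != 0 := expq_neq0 j.
have z0 : z != 0 := expq_neq0 (l - i)%N.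
rewrite -!muln2 (exprD q i j) (exprD q 2 (j * 2)) !(exprM q _ 2)
  (exprS q l) E -/x -/y -/z.
have -> : z * x / q * c ^+ 2 = z * x * c ^+ 2 / q by rewrite mulrAC.
have -> : q / (z * x) * a / c = q * a / (z * x * c) by field; nonzero.
have -> : q / (z * x) ^+ 2 * x ^+ 2 / c ^+ 2 = q * x ^+ 2 / ((z * x) ^+ 2 * c ^+ 2)
  by field; nonzero.
have -> : q / (z * x) ^+ 2 / c ^+ 2 = q / ((z * x) ^+ 2 * c ^+ 2) by field; nonzero.
have -> : q / (z * x) * a / c ^+ 2 = q * a / (z * x * c ^+ 2) by field; nonzero.
have -> : q / (z * x) / a = q / (z * x * a) by field; nonzero.
have -> : q ^+ 2 / (z * x) / c ^+ 2 = q ^+ 2 / (z * x * c ^+ 2) by field; nonzero.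
have -> : z * x / x * a = z * a by field.
have -> : q / (z * x) * x * a / c ^+ 2 = q * (z * a) / (z * c) ^+ 2 by field; nonzero.
have -> : q * (z * a) / (z * c) = q * a / c by field; nonzero.
have -> : - q * (z * a) / (z * c) = - q * a / c by field; nonzero.
have -> : q * (z * x) / x * y * a = q * (y * (z * a)) by field; nonzero.
have -> : q ^+ 2 / (z * x) * (x * y) * a / c ^+ 2 = q ^+ 2 * (y * (z * a)) / (z * c)
  ^+ 2 by field; nonzero.
have -> : q ^+ 2 * (y * (z * a)) ^+ 2 / (z * c) ^+ 2 = q ^+ 2 * y ^+ 2 * a ^+ 2 / c
  ^+ 2 by field; nonzero.
by rewrite !invfM; ring.
Qed.

(** [Psi_sum] expands the series in i; each term has l = 0 and is expanded in j by
    [Phi_norm_sum]. *)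
Lemma generic_identity a c l m n : generic a c -> (m <= n)%N ->
  phi43 n a c (q ^ (- n%:Z)) (- q ^ (1 - l%:Z - m%:Z + n%:Z) * a / c)
    (q ^ (1 - l%:Z) * a / c) (q ^ (1 - m%:Z + n%:Z) * a) (- q ^ (- n%:Z) * c)
    q q
  = qpochs q [:: a; c] l
      / qpochs q [:: q ^ (l%:Z - 1) * c ^+ 2; q ^ (1 - l%:Z) * a / c] l
    * (qpochs q [:: q ^ (1 - m%:Z + n%:Z); - q * a / c] n
         / qpochs q [:: q ^ (1 - m%:Z + n%:Z) * a; - q / c] n)
    * \sum_(i < l.+1) \sum_(j < m.+1) Tterm q a c l m n i j.
Proof.
move=> gen mn; have [a0 c0 ha hc hcc hac hnac] := gen.
have mE : q ^ (1 - m%:Z + n%:Z) = q * q ^+ n / q ^+ m.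
  by rewrite (@expz_linE 1 m n (1 - m%:Z + n%:Z)) // expr1 mulrAC.
have nE : q ^ (- n%:Z) = (q ^+ n)^-1.
  by rewrite (@expz_linE 0 n 0 (- n%:Z)) ?addr0 ?sub0r // mulr1 mul1r.
transitivity (Phi a c (q ^+ l) (q ^+ m) n).
  rewrite phi43E; apply: eq_bigr => k _; congr (phi43_term _ _ _ _ _ _ _ _) => //.
  - rewrite (@expz_linE n.+1 (l + m)%N 0 (1 - l%:Z - m%:Z + n%:Z)); last first.
      by rewrite intS PoszD; ring.
    by rewrite mulr1 exprD exprS; field; nonzero.
  - rewrite (@expz_linE 1 l 0 (1 - l%:Z)) ?addr0 // mulr1 expr1.
    by field; nonzero.
  - by rewrite mE mulrAC.
  - by rewrite nE mulNr mulrC mulNr.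
(* V / W is the second prefactor. *)
pose V := qpoch q (q * q ^+ n / q ^+ m) n * qpoch q (- q * a / c) n.
pose W := qpoch q (q * q ^+ n * a / q ^+ m) n * qpoch q (- q / c) n.
have V0 : V != 0.
  rewrite mulf_neq0 //.
    by apply/prodf_neq0 => k _; exact: qdiv_neq0.
  by apply: nonres_qpoch; rewrite -mulrA mulNr -mulrN; exact: nonres_mulq.
have W0 : W != 0.
  rewrite mulf_neq0 // nonres_qpoch //.
    by apply: nonres_div; rewrite -exprS; exact: nonres_shift.
  by rewrite mulNr -mulrN -invrN; apply/nonres_mulq/nonres_inv; rewrite ?oppr_eq0.
rewrite !mE [qpochs _ [:: q * _ / _; _] _]qpochs_cons [qpochs _ [:: q * _ / _ * _;
  _] _]qpochs_cons.
rewrite ![qpochs _ [:: _] n]qpochs_cons !qpochs_nil !mulr1.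
rewrite (_ : q * q ^+ n / q ^+ m * a = q * q ^+ n * a / q ^+ m); last by rewrite mulrAC.
rewrite -/V -/W; set P := qpochs q [:: a; c] l / _; set S := \sum_(i < l.+1) _.
have -> : P * (V / W) * S = V * (P * S) / W by ring.
apply: (mulfI W0); rewrite [RHS]mulrC divfK // -[W * Phi _ _ _ _ _]/(Psi a c l m n)
  Psi_sum //.
rewrite /S !mulr_sumr.
apply: eq_bigr => -[i /=]; rewrite ltnS => il _.
rewrite mulr_sumr.
under [in RHS]eq_bigr => j _ do rewrite Tterm_E // -1?ltnS // -mulrA.
rewrite -mulr_sumr -Phi_norm_sum //; last exact: generic_shift.
rewrite [RHS]mulrCA; congr (_ * _); rewrite /Phi_norm /Psi expr0.
(* The scaling by q^{l-i} cancels in a/c, so the same V serves for every i. *)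
have -> : - q * (q ^+ (l - i) * a) / (q ^+ (l - i) * c) = - q * a / c.
  by have z0 := expq_neq0 (l - i)%N; field; nonzero.
by rewrite -/V [RHS]mulrA [V * _]mulrC divfK.
Qed.

End QSeries.

(** * Specialization of rational functions *)

Section Specialization.
Variables (F : fieldType) (r : F).
Local Notation K := {fraction {poly F}}.
Local Notation "p %:K" := (FracField.tofrac p : K) (at level 2, format "p %:K").

(* The rational function x is regular at r, with value y there. *)
Definition spec (x : K) (y : F) :=
  exists p d : {poly F}, [/\ d.[r] != 0, x * d%:K = p%:K & y * d.[r] = p.[r]].

Lemma spec_tofrac p : spec p%:K p.[r].
Proof. by exists p, 1; rewrite hornerC oner_neq0 !mulr1. Qed.

Lemma spec1 : spec 1 1.
Proof. by have := spec_tofrac 1; rewrite hornerC rmorph1. Qed.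

Lemma specD x y x' y' : spec x y -> spec x' y' -> spec (x + x') (y + y').
Proof.
move=> [p [d [d0 xd yd]]] [p' [d' [d0' xd' yd']]].
exists (p * d' + p' * d), (d * d'); split.
- by rewrite hornerM mulf_neq0.
- by rewrite rmorphD !rmorphM /= -xd -xd'; ring.
- by rewrite hornerD !hornerM -yd -yd'; ring.
Qed.

Lemma specN x y : spec x y -> spec (- x) (- y).
Proof.
move=> [p [d [d0 xd yd]]]; exists (- p), d.
by rewrite d0 !mulNr xd yd rmorphN hornerN.
Qed.

Lemma specM x y x' y' : spec x y -> spec x' y' -> spec (x * x') (y * y').
Proof.
move=> [p [d [d0 xd yd]]] [p' [d' [d0' xd' yd']]].
exists (p * p'), (d * d'); split.
- by rewrite hornerM mulf_neq0.
- by rewrite !rmorphM /= -xd -xd'; ring.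
- by rewrite !hornerM -yd -yd'; ring.
Qed.

(** A zero numerator would give y d(r) = 0. At r = 1 this is how genericity over F(t) is obtained
    from numbers. *)
Lemma spec_neq0 x y : spec x y -> y != 0 -> x != 0.
Proof.
move=> [p [d [d0 xd yd]]]; apply: contraNneq => x0.
have : p.[r] = 0.
  have /eqP : p%:K = 0 by rewrite -xd x0 mul0r.
  by rewrite tofrac_eq0 => /eqP ->; rewrite horner0.
by rewrite -yd => /eqP; rewrite mulf_eq0 (negPf d0) orbF.
Qed.

Lemma specV x y : spec x y -> y != 0 -> spec x^-1 y^-1.
Proof.
move=> xy y0; have x0 := spec_neq0 _ _ xy y0.
have [p [d [d0 xd yd]]] := xy; exists d, p.
by rewrite -xd -yd mulf_neq0 // !mulKf.
Qed.

Lemma spec_div x y x' y' :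
  spec x y -> spec x' y' -> y' != 0 -> spec (x / x') (y / y').
Proof. by move=> xy xy' y0; apply: specM => //; exact: specV. Qed.

(** The zero function has value y - y' at r, and [spec_neq0] excludes a nonzero one. An identity
    over F(t) thus passes to the values. *)
Lemma spec_inj x y y' : spec x y -> spec x y' -> y = y'.
Proof.
move=> xy /specN /(specD _ _ _ _ xy); rewrite subrr => h.
by apply/eqP; rewrite -subr_eq0; apply: contraT => /(spec_neq0 _ _ h); rewrite eqxx.
Qed.

Lemma spec_exp x y n : spec x y -> spec (x ^+ n) (y ^+ n).
Proof.
move=> xy; elim: n => [|n IH]; first exact: spec1.
by rewrite !exprS; exact: specM.
Qed.

Lemma spec_expz x y (z : int) : spec x y -> y != 0 -> spec (x ^ z) (y ^ z).
Proof.
move=> xy y0; case: z => n; first exact: spec_exp.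
by rewrite NegzE -!exprnN; apply: specV; [exact: spec_exp | exact: expf_neq0].
Qed.

Lemma spec_sum n (f : 'I_n -> K) (g : 'I_n -> F) :
  (forall i, spec (f i) (g i)) -> spec (\sum_i f i) (\sum_i g i).
Proof.
move=> fg; elim/big_ind2: _ => [|x y x' y'|i _]; last exact: fg.
  by have := spec_tofrac 0; rewrite horner0 rmorph0.
exact: specD.
Qed.

Lemma spec_qpoch q q' x y n : spec q q' -> spec x y -> spec (qpoch q x n)
  (qpoch q' y n).
Proof.
move=> qq xy; rewrite /qpoch.
elim/big_ind2: _ => [|? ? ? ?|i _]; [exact: spec1 | exact: specM |].
by apply: specD; [exact: spec1 | apply/specN/specM => //; exact: spec_exp].
Qed.

Lemma spec_qpochs_nil q q' n : spec (qpochs q [::] n) (qpochs q' [::] n).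
Proof. by rewrite !qpochs_nil; exact: spec1. Qed.

Lemma spec_qpochs_cons q q' x y s t n : spec q q' -> spec x y ->
  spec (qpochs q s n) (qpochs q' t n) -> spec (qpochs q (x :: s) n)
    (qpochs q' (y :: t) n).
Proof.
by move=> qq xy st; rewrite !qpochs_cons; apply: specM => //; exact: spec_qpoch.
Qed.

End Specialization.

(** Follows the shape of the expression. [spec_div] is tried before [specM], because a quotient is
    also a product with an inverse. *)
Ltac spec_auto :=
  repeat first
  [ assumption | apply: spec1 | apply: spec_exp | apply: spec_expz
  | apply: spec_qpochs_nil | apply: spec_qpochs_cons
  | apply: specN | apply: specD | apply: spec_div | apply: specM ].

(** * Specialization of the two sides of the identity *)

Section Specialization.
Variables (F : fieldType) (r : F).
Local Notation K := {fraction {poly F}}.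
Local Notation spec := (spec F r).

Lemma spec_phi43 n q a0 a1 a2 a3 b1 b2 b3 q' a0' a1' a2' a3' b1' b2' b3' :
  spec q q' -> spec a0 a0' -> spec a1 a1' -> spec a2 a2' -> spec a3 a3' ->
  spec b1 b1' -> spec b2 b2' -> spec b3 b3' ->
  (forall k, (k <= n)%N -> qpochs q' [:: q'; b1'; b2'; b3'] k != 0) ->
  spec (phi43 n a0 a1 a2 a3 b1 b2 b3 q q) (phi43 n a0' a1' a2' a3' b1' b2' b3' q' q').
Proof.
move=> *; apply: spec_sum => k; spec_auto.
by match goal with h : forall k, _ |- _ => apply: h end; rewrite -ltnS.
Qed.

Section T.
Variables (q a c : K) (q' a' c' : F).
Hypotheses (hq : spec q q') (ha : spec a a') (hc : spec c c').

Lemma spec_Tterm l m n i j : q' != 0 -> a' != 0 -> c' != 0 ->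
 1 - q' ^ (1 - 2 * l%:Z) / c' ^+ 2 != 0 ->
     qpochs q' [:: q'; q' ^ (1 - l%:Z) / a'; q' ^ (2 - l%:Z) / c' ^+ 2] i != 0 ->
     qpochs q' [:: q'; q' * a' / c'; - q' * a' / c'; q' ^ (m%:Z - 2 * n%:Z);
                  q' ^ (j%:Z - 2 * n%:Z - 1)] j != 0 ->
     qpochs (q' ^+ 2) [:: q'; q' ^+ (2 + 2 * j) * a' ^+ 2 / c' ^+ 2] (n - j) != 0 ->
  spec (Tterm q a c l m n i j) (Tterm q' a' c' l m n i j).
Proof.
move=> q0 a0 c0 h1 h2 h3 h4; rewrite /Tterm.
have cc0 : c' ^+ 2 != 0 by rewrite expf_neq0.
by spec_auto.
Qed.
End T.

Definition line (u v : F) : K := FracField.tofrac (u%:P + (v - u)%:P * 'X).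

End Specialization.

Lemma spec_line0 (F : fieldType) (u v : F) : spec F 0 (line F u v) u.
Proof.
have := spec_tofrac F 0 (u%:P + (v - u)%:P * 'X).
by rewrite hornerD hornerM !hornerC hornerX mulr0 addr0.
Qed.

Lemma spec_line1 (F : fieldType) (u v : F) : spec F 1 (line F u v) v.
Proof.
have := spec_tofrac F 1 (u%:P + (v - u)%:P * 'X).
by rewrite hornerD hornerM !hornerC hornerX mulr1 (addrC u) subrK.
Qed.

(** * Genericity from the values at t = 1 *)

Lemma odd_mul_pow2 x y i j : odd x -> odd y -> x != y -> (x * 2 ^ i != y * 2 ^ j)%N.
Proof.
(* For different exponents, cancelling the smaller power of 2 leaves an odd number against an even
   one. *)
have aux u v k l : odd u -> (k < l)%N -> (u * 2 ^ k != v * 2 ^ l)%N.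
  move=> ou kl; rewrite -(subnK (ltnW kl)) expnD -subnSK // expnS mulnA eqn_pmul2r
    ?expn_gt0 //.
  by apply: contraTneq ou => ->; rewrite mulnCA oddM.
move=> ox oy xy; case: (ltngtP i j) => [ij|ji|->]; first exact: aux.
  by rewrite eq_sym aux.
by rewrite eqn_pmul2r ?expn_gt0.
Qed.

Section Main.
Variable F : numFieldType.

Lemma pow2_ratio_neq x y i j : odd x -> odd y -> x != y -> x%:R / y%:R * 2 ^+ i != 2
  ^+ j :> F.
Proof.
move=> ox oy xy; have y0 : y%:R != 0 :> F by rewrite pnatr_eq0; case: y oy {xy}.
rewrite mulrAC -(inj_eq (mulIf y0)) divfK // [_ * y%:R]mulrC -!natrX -!natrM eqr_nat.
exact: odd_mul_pow2.
Qed.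

Lemma pow2_ratioN_neq x y i j : odd x -> odd y -> - (x%:R / y%:R) * 2 ^+ i != 2 ^+ j
  :> F.
Proof.
move=> /odd_gt0 x0 /odd_gt0 y0.
rewrite mulNr eq_sym -addr_eq0 gt_eqF //.
by rewrite addr_gt0 ?mulr_gt0 ?invr_gt0 ?exprn_gt0 ?ltr0n.
Qed.

(** The difference u q^i - q^j has the nonzero value v 2^i - 2^j at t = 1. *)
Lemma nonres_spec (q u : {fraction {poly F}}) v :
  spec F 1 q 2 -> spec F 1 u v -> (forall i j, v * 2 ^+ i != 2 ^+ j) -> nonres _ q u.
Proof.
move=> hq hu h i j; rewrite -subr_eq0.
apply: (spec_neq0 _ 1 _ (v * 2 ^+ i - 2 ^+ j)); last by rewrite subr_eq0.
apply: specD; first by apply: specM => //; exact: spec_exp.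
by apply: specN; exact: spec_exp.
Qed.

(** The nonresonance conditions concern 3, -5, 25, 3/5 and -3/5 at t = 1, none of them an integer
    power of 2: the negative ones by sign, the others as quotients of distinct odd numbers. *)
Lemma generic_line (q a c : F) :
  generic _ (line F q 2) (line F a 3) (line F c 5).
Proof.
have hq := spec_line1 _ q 2; have ha := spec_line1 _ a 3; have hc := spec_line1 _ c 5.
have n3 : 3 != 0 :> F by rewrite pnatr_eq0.
have n5 : 5 != 0 :> F by rewrite pnatr_eq0.
have hac := spec_div _ _ _ _ _ _ ha hc n5.
split.
- exact: spec_neq0 ha _.
- exact: spec_neq0 hc _.
- apply: (nonres_spec _ _ _ hq ha) => i j.
  by rewrite -[3]divr1; exact: (pow2_ratio_neq 3 1).
- apply: (nonres_spec _ _ _ hq (specN _ _ _ _ hc)) => i j.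
  by rewrite -[5]divr1; exact: (pow2_ratioN_neq 5 1).
- apply: (nonres_spec _ _ _ hq (spec_exp _ _ _ _ 2 hc)) => i j.
  by rewrite -natrX -[(5 ^ 2)%:R]divr1; exact: (pow2_ratio_neq 25 1).
- by apply: (nonres_spec _ _ _ hq hac) => i j; exact: (pow2_ratio_neq 3 5).
- by apply: (nonres_spec _ _ _ hq (specN _ _ _ _ hac)) => i j;
  exact: (pow2_ratioN_neq 3 5).
Qed.

Lemma line_nonroot (q : F) k : line F q 2 ^+ k.+1 != 1.
Proof.
rewrite -subr_eq0; apply: (spec_neq0 _ 1 _ (2 ^+ k.+1 - 1)).
  by apply: specD; [apply: spec_exp; exact: spec_line1 | apply: specN; exact: spec1].
by rewrite subr_eq0 -natrX (eqr_nat _ _ 1) -[1%N](expn0 2) eqn_exp2l.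
Qed.

End Main.

Theorem mainTheorem10 (R : realType) (q a c : R[i]) (l m n : nat)
  (hq : q != 0) (ha : a != 0) (hc : c != 0) (hmn : (m <= n)%N)
  (* no zero factor in a denominator of the left-hand side *)
  (hphi : forall k : nat, (k <= n)%N ->
     qpochs q [:: q; q ^ (1 - l%:Z) * a / c; q ^ (1 - m%:Z + n%:Z) * a;
                  - q ^ (- n%:Z) * c] k != 0)
  (* nor of the two prefactors *)
  (hpre1 : qpochs q [:: q ^ (l%:Z - 1) * c ^+ 2; q ^ (1 - l%:Z) * a / c] l != 0)
  (hpre2 : qpochs q [:: q ^ (1 - m%:Z + n%:Z) * a; - q / c] n != 0)
  (* nor of the T_{i,j} *)
  (hT0 : 1 - q ^ (1 - 2 * l%:Z) / c ^+ 2 != 0)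
  (hTi : forall i : nat, (i <= l)%N ->
     qpochs q [:: q; q ^ (1 - l%:Z) / a; q ^ (2 - l%:Z) / c ^+ 2] i != 0)
  (hTj : forall j : nat, (j <= m)%N ->
     qpochs q [:: q; q * a / c; - q * a / c; q ^ (m%:Z - 2 * n%:Z);
                  q ^ (j%:Z - 2 * n%:Z - 1)] j != 0)
  (hTnj : forall j : nat, (j <= m)%N ->
     qpochs (q ^+ 2) [:: q; q ^+ (2 + 2 * j) * a ^+ 2 / c ^+ 2] (n - j) != 0) :
  phi43 n a c (q ^ (- n%:Z)) (- q ^ (1 - l%:Z - m%:Z + n%:Z) * a / c)
    (q ^ (1 - l%:Z) * a / c) (q ^ (1 - m%:Z + n%:Z) * a) (- q ^ (- n%:Z) * c)
    q q
  = qpochs q [:: a; c] l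
      / qpochs q [:: q ^ (l%:Z - 1) * c ^+ 2; q ^ (1 - l%:Z) * a / c] l
    * (qpochs q [:: q ^ (1 - m%:Z + n%:Z); - q * a / c] n
         / qpochs q [:: q ^ (1 - m%:Z + n%:Z) * a; - q / c] n)
    * \sum_(i < l.+1) \sum_(j < m.+1) Tterm q a c l m n i j.
Proof.
pose qK := line R[i] q 2; pose aK := line R[i] a 3; pose cK := line R[i] c 5.
have sq : spec R[i] 0 qK q := spec_line0 R[i] q 2.
have sa : spec R[i] 0 aK a := spec_line0 R[i] a 3.
have sc : spec R[i] 0 cK c := spec_line0 R[i] c 5.
have q0 : qK != 0 := spec_neq0 _ _ _ _ sq hq.
have := generic_identity _ qK q0 (line_nonroot _ q) aK cK l m n (generic_line _ q a
  c) hmn.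
(* Values at t = 0 are unique. The left-hand side over F(t) has the desired left-hand side as its
   value there; by E it equals the right-hand side over F(t), whose value is the desired right-hand
   side. *)
move=> E; apply: (spec_inj R[i] 0 (phi43 n aK cK (qK ^ (- n%:Z))
  (- qK ^ (1 - l%:Z - m%:Z + n%:Z) * aK / cK)
    (qK ^ (1 - l%:Z) * aK / cK) (qK ^ (1 - m%:Z + n%:Z) * aK) (- qK ^ (- n%:Z) * cK)
    qK qK)).
  (* Regularity at t = 0 comes from [hphi], which covers k <= n, the range of the truncated sum. *)
  apply: spec_phi43 => //; spec_auto.
rewrite {}E; apply: specM; last first.
  apply: spec_sum => i; apply: spec_sum => j; apply: spec_Tterm => //.
  - by apply: hTi; rewrite -ltnS.
  - by apply: hTj; rewrite -ltnS.
  - by apply: hTnj; rewrite -ltnS.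
by spec_auto.
Qed.
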